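(* Let $K\ge 3$, let $X_1,\dots,X_K$ be Polish spaces, and let $\mu_k\in\mathcal P(X_k)$ for $k=1,\dots,K$. Let $c:X_1\times\cdots\times X_K\to\mathbb R$ be bounded and continuous. Then $$\mathsf{MOT}_c(\mu_1,\dots,\mu_K)=\inf_{\pi\in\Pi(\mu_1,\dots,\mu_K)} I(\pi)=\sup_{\boldsymbol f\in\mathcal F_c}J(\boldsymbol f).$$
   Context: $\mathcal P(X)$ is the set of Borel probability measures on $X$. $\Pi(\mu_1,\dots,\mu_K)$ is the set of $\pi\in\mathcal P(X_1\times\cdots\times X_K)$ whose $k$-th marginal is $\mu_k$ for every $k$. Define $I(\pi)=\int_{X_1\times\cdots\times X_K}c\,d\pi$ and $\mathsf{MOT}_c(\mu_1,\dots,\mu_K)=\inf_{\pi\in\Pi(\mu_1,\dots,\mu_K)}I(\pi)$. For a family $\boldsymbol f=(f_1,\dots,f_K)$ with $f_k\in L^1(\mu_k)$, define $J(\boldsymbol f)=\sum_{k=1}^K\int_{X_k}f_k\,d\mu_k$. The admissible class $\mathcal F_c$ is the set of families $\boldsymbol f=(f_1,\dots,f_K)$ such that each $f_k:X_k\to\mathbb R$ is Borel with $f_k\in L^1(\mu_k)$, and $\sum_{k=1}^K f_k(x_k)\le c(x_1,\dots,x_K)$ for all $(x_1,\dots,x_K)\in X_1\times\cdots\times X_K$. *)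

(* Defs.v *)
From HB Require Import structures.
From mathcomp Require Import all_boot all_order all_algebra.
From mathcomp Require Import all_classical all_reals all_analysis.
Import Order.TTheory GRing.Theory Num.Theory.
Import numFieldNormedType.Exports.

Set Implicit Arguments.
Unset Strict Implicit.
Unset Printing Implicit Defensive.

Local Open Scope classical_set_scope.
Local Open Scope ring_scope.

Definition is_metric (R : realType) (T : Type) (d : T -> T -> R) : Prop :=
  [/\ forall x y, d x y = 0 <-> x = y,
      forall x y, d x y = d y x &
      forall x y z, d x z <= d x y + d y z].

Definition induces_topology (R : realType) (T : topologicalType)
    (d : T -> T -> R) : Prop :=
  forall x : T,
    nbhs x = filter_from [set e : R | 0 < e] (fun e => [set y | d x y < e]).

Definition is_complete_metric (R : realType) (T : topologicalType)
    (d : T -> T -> R) : Prop :=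
  forall u : nat -> T,
    (forall e : R, 0 < e -> \forall m & n \near \oo, d (u m) (u n) < e) ->
    exists l : T, u @ \oo --> l.

Definition separable (T : topologicalType) : Prop :=
  exists2 D : set T, countable D & dense D.

Definition polish (R : realType) (T : topologicalType) : Prop :=
  separable T /\
  exists d : T -> T -> R,
    [/\ is_metric d, induces_topology d & is_complete_metric d].

(* The Borel sigma-algebra. [measurableType] extends [pointedType] in this
   library, hence [ptopologicalType]; a space carrying a probability measure is
   nonempty anyway. *)
Definition borel (T : ptopologicalType) : Type := g_sigma_algebraType (@open T).

HB.instance Definition _ (T : ptopologicalType) :=
  Measurable.copy (borel T) (g_sigma_algebraType (@open T)).

HB.instance Definition _ (I : Type) (T : I -> ptopologicalType) :=
  Pointed.copy (prod_topology T) (forall i, T i).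

Section multimarginal.
Context (R : realType) (K : nat) (X : 'I_K -> ptopologicalType).

Definition couplings (mu : forall k, probability (borel (X k)) R) :
    set (probability (borel (prod_topology X)) R) :=
  [set pi : probability (borel (prod_topology X)) R |
     forall k (A : set (borel (X k))), measurable A ->
       pushforward pi (fun x : borel (prod_topology X) => x k : borel (X k)) A
       = mu k A].

Definition transport_cost (c : prod_topology X -> R)
    (pi : probability (borel (prod_topology X)) R) : \bar R :=
  (\int[pi]_x (c x)%:E)%E.

Definition MOT (c : prod_topology X -> R)
    (mu : forall k, probability (borel (X k)) R) : \bar R :=
  ereal_inf [set transport_cost c pi | pi in couplings mu].

Definition dual_value (mu : forall k, probability (borel (X k)) R)
    (f : forall k, X k -> R) : \bar R :=
  (\sum_(k < K) \int[mu k]_x (f k x)%:E)%E.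

Definition admissible (c : prod_topology X -> R)
    (mu : forall k, probability (borel (X k)) R) : set (forall k, X k -> R) :=
  [set f | [/\ forall k, measurable_fun [set: borel (X k)] (f k),
      forall k, (mu k).-integrable [set: borel (X k)] (EFin \o f k) &
      forall x : prod_topology X, \sum_(k < K) f k (x k) <= c x]].

End multimarginal.

(* Main.v *)
(* Weak duality is integration of the pointwise constraint against a coupling.
   For the converse, discretise. By tightness and completeness each X_k is cut
   into finitely many Borel cells, those not called good having small total
   mu_k-mass, so that c oscillates by at most e on products of good cells:
   otherwise pairs of points witnessing larger oscillation on ever finer cells
   would, along an ultrafilter, converge to a common point, at which c is not
   continuous.
   Replacing c by a minorant C constant on product cells turns the problem into
   a finite linear program; its dual feasible points are admissible step
   functions, so its dual value is at most the supremum S. Farkas' lemma yields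
   a primal feasible discrete coupling of C-cost at most S, and spreading each
   of its atoms over the corresponding product cell, by any coupling of the
   conditional laws of the mu_k, gives a coupling of the mu_k whose c-cost
   exceeds S by little. *)

Require Import Defs.
From HB Require Import structures.
From mathcomp Require Import all_boot all_order all_algebra.
From mathcomp Require Import all_classical all_reals all_analysis.
From mathcomp Require Import measurable_realfun.
From mathcomp Require Import ring lra.
Import Order.TTheory GRing.Theory Num.Theory.
Import numFieldNormedType.Exports.

Set Implicit Arguments.
Unset Strict Implicit.
Unset Printing Implicit Defensive.

Local Open Scope classical_set_scope.
Local Open Scope ring_scope.

(** * Farkas' lemma and the finite problem *)

Section farkas.
Variables (R : realFieldType) (V : lmodType R) (I : eqType).

(** Induction on the constraints, so [V] may be any module. If the implication survives dropping
    [a j], the multiplier of [a j] is zero. Otherwise some [x0] satisfies the other constraints with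
    [b x0 > 0], which forces [a j x0 > 0], and one eliminates along [x0]. *)
Lemma farkas_seq (s : seq I) (a : I -> V -> R) (b : V -> R) :
  uniq s -> (forall i, scalar (a i)) -> scalar b ->
  (forall x, (forall i, i \in s -> a i x <= 0) -> b x <= 0) ->
  exists2 l : I -> R, forall i, 0 <= l i &
    forall x, b x = \sum_(i <- s) l i * a i x.
Proof.
elim: s a b => [|j s IH] a b /=.
  move=> _ _ lb b0; exists (fun=> 0) => // x; rewrite big_nil.
  have bN : b (- x) = - b x.
    have := lb (-1) x 0; have := lb 1 0 0.
    by rewrite addr0 scaler0 mulN1r scaleN1r addr0 => ? ->; lra.
  have h y : b y <= 0 by apply: b0 => i; rewrite in_nil.
  by apply/eqP; rewrite eq_le h -oppr_le0 -bN h.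
move=> /andP[js us] la lb hb.
have [h|] := pselect (forall x, (forall i, i \in s -> a i x <= 0) -> b x <= 0).
  have [l l0 lE] := IH a b us la lb h.
  exists (fun i => if i == j then 0 else l i) => [i|x]; first by case: ifP.
  rewrite big_cons eqxx mul0r add0r lE; apply: eq_big_seq => i iS.
  by case: eqP => // ij; rewrite -ij iS in js.
move=> /existsNP[x0 /not_implyP[ax0 /negP]]; rewrite -ltNge => bx0.
have ajx0 : 0 < a j x0.
  rewrite ltNge; apply/negP => aj0; move: bx0; apply/negP; rewrite -leNgt.
  by apply: hb => i; rewrite inE => /predU1P[->//|/ax0].
pose t := a j x0; have t0 : t != 0 by rewrite gt_eqF.
(* [a'] and [b'] are the functionals composed with the projection along [x0] onto the kernel of
   [a j]; on that kernel the constraint [a j] holds trivially. *)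
pose a' i x := a i x - a i x0 / t * a j x.
pose b' x := b x - b x0 / t * a j x.
have linP f : scalar f -> scalar (fun x => f x - f x0 / t * a j x).
  by move=> lf k x y; rewrite lf la; ring.
have [|l l0 lE] := IH a' b' us (fun i => linP _ (la i)) (linP _ lb).
  move=> x a'x; pose y := (- (a j x / t)) *: x0 + x.
  have fy f : scalar f -> f y = f x - f x0 / t * a j x.
    by move=> lf; rewrite lf; ring.
  rewrite /b' -fy//; apply: hb => i; rewrite inE => /predU1P[->|iS].
    by rewrite fy// mulfV// mul1r subrr.
  by rewrite fy//; exact: a'x.
(* The multiplier of [a j] comes from expanding [b' = \sum l i * a' i] and collecting the multiples
   of [a j x]. It is nonnegative because [b x0 > 0] and [a i x0 <= 0] on [s]. *)
exists (fun i => if i == j then (b x0 - \sum_(i <- s) l i * a i x0) / t else l i).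
  move=> i; case: ifP => // _; apply: divr_ge0; last exact: ltW.
  rewrite subr_ge0; apply: le_trans (ltW bx0); rewrite big_seq.
  by apply: sumr_le0 => k ks; apply: mulr_ge0_le0 => //; exact: ax0.
move=> x; rewrite big_cons eqxx.
have -> : b x = b' x + b x0 / t * a j x by rewrite /b'; ring.
rewrite lE (eq_bigr (fun i => l i * a i x - l i * a i x0 * (a j x / t))).
  rewrite sumrB -mulr_suml.
  under [in RHS]eq_big_seq => i iS.
    rewrite (_ : (i == j) = false); last by apply: contraNF js => /eqP <-.
  over.
  by rewrite /=; ring.
by move=> i _; rewrite /a'; ring.
Qed.

End farkas.

Lemma farkas (R : realFieldType) (V : lmodType R) (I : finType)
    (a : I -> V -> R) (b : V -> R) :
  (forall i, scalar (a i)) -> scalar b ->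
  (forall x, (forall i, a i x <= 0) -> b x <= 0) ->
  exists2 l : I -> R, forall i, 0 <= l i & forall x, b x = \sum_i l i * a i x.
Proof.
move=> la lb h.
have [x ax|l l0 lE] := @farkas_seq R V I _ a b (enum_uniq I) la lb.
  by apply: h => i; apply: ax; rewrite mem_enum.
by exists l => // x; rewrite lE big_enum.
Qed.

(** Farkas' lemma for the homogenised dual program: a vector consists of potentials [x.1] and a
    scale [x.2], with constraints [\sum_k x.1 (k, w k) <= x.2 * C w] and [0 <= x.2]. The multipliers
    of the constraints indexed by [w] are the masses of the coupling. *)
Lemma finite_multimarginal_duality (R : realFieldType) (K : nat) (L : finType)
    (p : 'I_K -> L -> R) (C : {ffun 'I_K -> L} -> R) (B S : R) :
  (0 < K)%N -> (forall k, \sum_j p k j = 1) -> (forall w, - B <= C w) ->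
  (forall psi : 'I_K -> L -> R,
    (forall w : {ffun 'I_K -> L}, \sum_k psi k (w k) <= C w) ->
    \sum_k \sum_j psi k j * p k j <= S) ->
  exists g : {ffun 'I_K -> L} -> R,
    [/\ forall w, 0 <= g w,
        forall k j, \sum_(w : {ffun 'I_K -> L} | w k == j) g w = p k j &
        \sum_w g w * C w <= S].
Proof.
move=> K0 p1 CB dualS.
pose V := ({ffun 'I_K * L -> R^o} * R^o)%type.
pose a (o : option {ffun 'I_K -> L}) (x : V) : R :=
  if o is Some w then \sum_k x.1 (k, w k) - x.2 * C w else - x.2.
pose b (x : V) : R := \sum_k \sum_j x.1 (k, j) * p k j - x.2 * S.
have comb1 t (x y : V) kj : (t *: x + y).1 kj = t * x.1 kj + y.1 kj.
  by rewrite !ffunE.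
have comb2 t (x y : V) : (t *: x + y).2 = t * x.2 + y.2 by [].
have la o : scalar (a o).
  case: o => [w|] t x y; rewrite /a comb2; last by ring.
  under eq_bigr do rewrite comb1.
  by rewrite big_split/= -mulr_sumr; ring.
have lb : scalar b.
  move=> t x y; rewrite /b comb2.
  under eq_bigr do under eq_bigr do rewrite comb1 mulrDl -mulrA.
  under eq_bigr do rewrite big_split/= -mulr_sumr.
  by rewrite big_split/= -mulr_sumr; ring.
have K0R : K%:R != 0 :> R by rewrite pnatr_eq0 -lt0n.
have [x ax|l l0 lE] := farkas la lb.
  have t0 : 0 <= x.2 by rewrite -oppr_le0; exact: (ax None).
  (* A small multiple of the feasible constant potentials makes the
     homogenising coordinate positive, which covers the case [x.2 = 0]. *)
  suff h s : 0 < s -> \sum_k \sum_j x.1 (k, j) * p k j <= x.2 * S + s * (S + B).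
    rewrite /b subr_le0; apply/ler_addgt0Pr => e e0.
    have n0 : 0 < `|S + B| + 1 by rewrite ltr_pwDr.
    apply: le_trans (h _ (divr_gt0 e0 n0)) _; rewrite lerD2l.
    rewrite -mulrA mulrC -ler_pdivlMr ?divff ?gt_eqF//.
    by rewrite mulrC ler_pdivrMr// mul1r (le_trans (ler_norm _))// lerDl.
  move=> s0; have ts0 : 0 < x.2 + s by rewrite ltr_wpDl.
  have sBK : s * (B / K%:R) *+ K = s * B.
    by rewrite -[LHS]mulr_natr -mulrA divfK.
  (* The constant potentials [- B / K] sum to [- B], below [C]. Adding [s] times these to [x.1] and
     dividing by the new scale [x.2 + s] gives a feasible family. *)
  have := dualS (fun k j => (x.1 (k, j) - s * (B / K%:R)) / (x.2 + s)).
  have -> : \sum_k \sum_j (x.1 (k, j) - s * (B / K%:R)) / (x.2 + s) * p k j =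
      (\sum_k \sum_j x.1 (k, j) * p k j - s * B) / (x.2 + s).
    transitivity
      (\sum_k ((\sum_j x.1 (k, j) * p k j - s * (B / K%:R)) / (x.2 + s))).
      apply: eq_bigr => k _; rewrite -[s * (B / _) in RHS]mulr1 -(p1 k) mulr_sumr.
      rewrite -sumrB mulr_suml; apply: eq_bigr => j _.
      by rewrite mulrAC mulrBl.
    by rewrite -mulr_suml sumrB sumr_const card_ord sBK.
  rewrite ler_pdivrMr// => h; rewrite -subr_ge0.
  have {}h : \sum_k \sum_j x.1 (k, j) * p k j - s * B <= S * (x.2 + s).
    apply: h => w; rewrite -mulr_suml ler_pdivrMr// sumrB sumr_const card_ord sBK.
    have := ax (Some w); rewrite /= subr_le0 => axw.
    have := ler_wpM2l (ltW s0) (CB w); rewrite mulrN => sB.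
    by rewrite mulrDr [C w * x.2]mulrC [C w * s]mulrC; apply: lerD.
  by lra.
exists (fun w => l (Some w)).
have sumE (f : option {ffun 'I_K -> L} -> R) :
    \sum_o f o = f None + \sum_w f (Some w).
  rewrite (bigD1 None)//=; congr (_ + _).
  rewrite (reindex_omap Some id) => [|[]//].
  by apply: eq_bigl => w; rewrite eqxx.
split => // [k j|].
  (* The Farkas identity at the basis vector of [(k, j)] is the marginal equation. *)
  have := lE ([ffun kj => (kj == (k, j))%:R], 0).
  rewrite sumE /a /b /= mul0r oppr0 mulr0 add0r addr0.
  rewrite (bigD1 k)//= [X in _ + X]big1 => [|k' k'k]; last first.
    rewrite big1// => j' _; rewrite ffunE.
    by rewrite (_ : _ == _ = false) ?mul0r//; apply: contraNF k'k => /eqP[->].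
  rewrite (bigD1 j)//= big1 => [|j' j'j]; last first.
    rewrite ffunE (_ : _ == _ = false) ?mul0r//.
    by apply: contraNF j'j => /eqP[->].
  rewrite ffunE eqxx mul1r !addr0 => ->; rewrite big_mkcond.
  apply: eq_bigr => w _; rewrite mul0r subr0 (bigD1 k)//= big1 => [|k' k'k].
    rewrite ffunE addr0 xpair_eqE eqxx/=; case: eqP => _; by rewrite ?mulr1 ?mulr0.
  by rewrite ffunE xpair_eqE (negbTE k'k).
(* At the unit vector of the scale the identity reads [S = \sum_w g w * C w + l None], with
   [l None >= 0] as slack. *)
have := lE (0, 1); rewrite sumE /a /b /=.
rewrite big1 => [|k _]; last by rewrite big1// => j _; rewrite ffunE mul0r.
rewrite mul1r sub0r mulrN1 => SE.
move: SE; rewrite [X in _ + X](eq_bigr (fun w => - (l (Some w) * C w))).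
  by rewrite sumrN; have := l0 None; lra.
by move=> w _; rewrite big1 ?mul1r ?sub0r ?mulrN// => k _; rewrite ffunE.
Qed.

(** * Polish spaces, product topology and Borel sets *)

Lemma forall_exists_fun (I : Type) (T : I -> Type) (P : forall i, T i -> Prop) :
  (forall i, exists x, P i x) -> exists f : forall i, T i, forall i, P i (f i).
Proof. by move=> h; exists (fun i => sval (cid (h i))) => i; case: cid. Qed.

Lemma metric_refl (R : realType) (T : Type) (d : T -> T -> R) x :
  is_metric d -> d x x = 0.
Proof. by move=> [h _ _]; apply/h. Qed.

Lemma metric_ball_open (R : realType) (T : topologicalType) (d : T -> T -> R)
    (x : T) (e : R) :
  is_metric d -> induces_topology d -> open [set y | d x y < e].
Proof.
move=> [_ _ tri] ind; rewrite openE => y /= xy.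
rewrite /interior ind; exists (e - d x y); first by rewrite /= subr_gt0.
by move=> z /= yz; apply: le_lt_trans (tri _ y _) _; rewrite -ltrBrDl.
Qed.

Lemma metric_ball_nbhs (R : realType) (T : topologicalType) (d : T -> T -> R)
    (x : T) (e : R) :
  induces_topology d -> 0 < e -> nbhs x [set y | d x y < e].
Proof. by move=> ind e0; rewrite ind; exists e. Qed.

Lemma separable_dense_seq (R : realType) (T : ptopologicalType)
    (d : T -> T -> R) :
  separable T -> is_metric d -> induces_topology d ->
  exists p : nat -> T, forall x e, 0 < e -> exists n, d (p n) x < e.
Proof.
move=> [D /countable_injP[f fi] Dd] md ind.
(* Integers that code no point of [D] are sent to the default [point]; this is harmless, since only
   density of the range is claimed. *)
exists (fun n => xget point (D `&` f @^-1` [set n])) => x e e0.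
have [|y [/= xy Dy]] := Dd [set y | d x y < e] _ (metric_ball_open x e md ind).
  by exists x; rewrite /= (metric_refl x md).
exists (f y); case: xgetP => [_ -> [Dz /= fz]|/(_ y)]; last by case.
have -> : xget point (D `&` f @^-1` [set f y]) = y.
  by case: xgetP => [_ -> [Dw fw]|/(_ y)]; [apply: fi => //; rewrite inE|case].
by case: md => _ -> _.
Qed.

Lemma cvg_prod_topology (I : Type) (X : I -> topologicalType)
    (F : set_system (prod_topology X)) (x : prod_topology X) :
  Filter F -> (forall i, (fun f : prod_topology X => f i) @ F --> x i) ->
  F --> x.
Proof.
move=> FF h; apply/cvg_sup => i A /=.
rewrite (@nbhsE (initial_topology (fun f : prod_topology X => f i))) => -[B].
move=> [[/= C oC <-] Cx] BA; apply: filterS BA _.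
by apply: (h i); apply: open_nbhs_nbhs.
Qed.

(** The boxes around [x] generate a filter converging to [x] in each coordinate, hence in the
    product topology; so every neighbourhood of [x] contains a box. *)
Lemma nbhs_prod_box (R : realType) (I : finType) (X : I -> topologicalType)
    (d : forall i, X i -> X i -> R) (x : prod_topology X)
    (U : set (prod_topology X)) :
  (forall i, induces_topology (d i)) -> nbhs x U ->
  exists2 e : R, 0 < e & forall y, (forall i, d i (x i) (y i) < e) -> U y.
Proof.
move=> ind.
pose box (e : R) := [set y : prod_topology X | forall i, d i (x i) (y i) < e].
pose F := filter_from [set e : R | 0 < e] box.
have FF : Filter F.
  apply: filter_from_filter; first by exists 1; exact: ltr01.
  move=> e1 e2 /= e10 e20; exists (Num.min e1 e2); first by rewrite /= lt_min e10.
  by move=> y yb; split=> i; have := yb i; rewrite lt_min => /andP[].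
suff : F --> x by move=> h /h [e e0 ?]; exists e.
apply: cvg_prod_topology => i A; rewrite ind => -[e e0 eA].
by exists e => // y yb; apply: eA; exact: yb.
Qed.

Lemma continuous_measurable_borel (T : ptopologicalType) (R : realType)
    (f : T -> R) :
  continuous f -> measurable_fun [set: borel T] (f : borel T -> R).
Proof.
move=> cf; apply: (measurability _ (measurable_realfun.RGenOpens.measurableE R)).
move=> _ [_ [a [b ->] <-]]; rewrite setTI; apply: sub_sigma_algebra.
by move/continuousP : cf; apply; exact: interval_open.
Qed.

Lemma measurable_fun_to_borel d (Y : measurableType d) (T : ptopologicalType)
    (f : Y -> borel T) :
  (forall U : set T, open U -> measurable (f @^-1` U)) ->
  measurable_fun [set: Y] f.
Proof.
move=> h; apply: (@measurability _ _ _ (borel T) _ _ (@open T)) => //.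
by move=> _ [U oU <-]; rewrite setTI; exact: h.
Qed.

Lemma measurable_fun_proj (I : Type) (X : I -> ptopologicalType) (i : I) :
  measurable_fun [set: borel (prod_topology X)]
    (fun x : borel (prod_topology X) => x i : borel (X i)).
Proof.
apply: measurable_fun_to_borel => U oU; apply: sub_sigma_algebra.
by apply: open_comp => // x _; exact: (@proj_continuous {classic I} X i).
Qed.

(* Second countability makes the Borel sets of the product generated by
   finite boxes of balls with centres in dense sequences. *)
Lemma measurable_fun_prod (R : realType) d (Y : measurableType d) (I : finType)
    (X : I -> ptopologicalType) (f : Y -> borel (prod_topology X)) :
  (forall i, polish R (X i)) ->
  (forall i, measurable_fun [set: Y] (fun y => f y i : borel (X i))) ->
  measurable_fun [set: Y] f.
Proof.
move=> hX mf; apply: measurable_fun_to_borel => U oU.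
have /forall_exists_fun[D hD] : forall i, exists D : X i -> X i -> R,
    is_metric D /\ induces_topology D.
  by move=> i; have [_ [D [mD iD _]]] := hX i; exists D.
have /forall_exists_fun[p hp] : forall i, exists p : nat -> X i,
    forall x e, 0 < e -> exists n, D i (p n) x < e.
  move=> i; have [mD iD] := hD i; have [s _] := hX i.
  exact: separable_dense_seq s mD iD.
pose box (w : {ffun I -> nat} * nat) : set (prod_topology X) :=
  [set x | forall i, D i (p i (w.1 i)) (x i) < w.2.+1%:R^-1].
(* The boxes have countably many indices; those not inside [U] are replaced by the empty set. *)
have UE : U = \bigcup_w (if `[< box w `<=` U >] then box w else set0).
  apply/seteqP; split=> [x Ux|x [w _]]; last by case: asboolP => // + bx; exact.
  have [e e0 he] := nbhs_prod_box (fun i => (hD i).2)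
    (open_nbhs_nbhs (conj oU Ux)).
  (* A box of radius [m.+1%:R^-1] that contains [x] lies within twice that radius of [x] in every
     coordinate. *)
  have [m me] : exists m : nat, m.+1%:R^-1 *+ 2 < e.
    have [m me] : exists m : nat, m.+1%:R^-1 < e / 2.
      have e20 : 0 < e / 2 by rewrite divr_gt0.
      have [m] := ltr_add_invr e20; rewrite add0r => ?; by exists m.
    by exists m; rewrite mulr2n [ltRHS]splitr ltrD.
  have /forall_exists_fun[n hn] : forall i, exists n, D i (p i n) (x i) < m.+1%:R^-1.
    by move=> i; apply: hp; rewrite invr_gt0.
  exists ([ffun i => n i], m) => //; case: asboolP => [_|[]].
    by move=> i /=; rewrite ffunE.
  move=> y yb; apply: he => i; have := yb i; have := hn i; rewrite /= ffunE.
  have [[_ sym tri] _] := hD i => h1 h2.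
  apply: le_lt_trans me; apply: le_trans (tri _ (p i (n i)) _) _.
  by rewrite sym mulr2n lerD// ltW.
rewrite UE preimage_bigcup; apply: countable_bigcupT_measurable => [|w]; first exact: countableP.
case: asboolP => _; last by rewrite preimage_set0.
rewrite (_ : f @^-1` box w = \bigcap_i ((fun y => f y i) @^-1`
    [set z | D i (p i (w.1 i)) z < w.2.+1%:R^-1])); last first.
  by apply/seteqP; split=> y /= h i => [_|]; [exact: h|exact: (h i Logic.I)].
apply: fin_bigcap_measurable => // i _; rewrite -[X in measurable X]setTI.
apply: mf => //; apply: sub_sigma_algebra.
by have [mD iD] := hD i; exact: metric_ball_open mD iD.
Qed.

(** * Fine partitions *)

(** A totally bounded set: at each scale [l.+1%:R^-1] the first [n l] balls cover it. It takes the
    place of the compact set in the tightness argument. *)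
Definition finitely_covered (R : realType) (T : Type) (d : T -> T -> R)
    (p : nat -> T) (n : nat -> nat) : set T :=
  [set x | forall l, exists2 i, (i < n l)%N & d (p i) x < l.+1%:R^-1].

Lemma ultra_bigcup (T : Type) (F : set_system T) (A : nat -> set T) (n : nat) :
  UltraFilter F -> F [set x | exists2 i, (i < n)%N & A i x] ->
  exists i, F (A i).
Proof.
move=> FU; elim: n => [h|n IH h].
  by have [x []] := filter_ex h.
have [FA|FNA] := in_ultra_setVsetC (A n) FU; first by exists n.
apply: IH; apply: filterS2 h FNA => x [i]; rewrite ltnS leq_eqVlt.
by move=> /predU1P[-> //|ni Ai _]; exists i.
Qed.

(* The sequential content of "complete and totally bounded implies compact". *)
Lemma ultra_totally_bounded_cvg (R : realType) (T : topologicalType)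
    (d : T -> T -> R) (p : nat -> T) (n : nat -> nat) (x : nat -> T)
    (F : set_system nat) :
  is_metric d -> induces_topology d -> is_complete_metric d -> UltraFilter F ->
  (forall m, finitely_covered d p n (x m)) ->
  exists z : T, x @ F --> z.
Proof.
move=> [d0 sym tri] ind comp FU xp.
(* At each scale the ultrafilter selects one of the finitely many balls. *)
have /choice[i hi] : forall l, exists i, F [set m | d (p i) (x m) < l.+1%:R^-1].
  move=> l; apply: (@ultra_bigcup _ _ _ (n l)).
  by apply: filterS filterT => m _; exact: xp m l.
(* [x (s l)] lies in the selected balls of all scales up to [l], so [x \o s] is a Cauchy
   sequence. *)
have /choice[s hs] : forall l, exists m, forall j, (j <= l)%N ->
    d (p (i j)) (x m) < j.+1%:R^-1.
  move=> l; suff : F [set m | forall j, (j <= l)%N ->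
      d (p (i j)) (x m) < j.+1%:R^-1] by move/filter_ex.
  elim: l => [|l IH].
    by apply: filterS (hi 0%N) => m h j; rewrite leqn0 => /eqP ->.
  apply: filterS2 IH (hi l.+1) => m h hl j; rewrite leq_eqVlt.
  by move=> /predU1P[->//|]; rewrite ltnS; exact: h.
have close l a b : d (p (i l)) a < l.+1%:R^-1 -> d (p (i l)) b < l.+1%:R^-1 ->
    d a b < l.+1%:R^-1 + l.+1%:R^-1.
  by move=> ha hb; apply: le_lt_trans (tri _ (p (i l)) _) _; rewrite sym ltrD.
have small (e : R) : 0 < e -> exists l : nat, l.+1%:R^-1 + l.+1%:R^-1 < e.
  move=> e0; have [l] := ltr_add_invr (divr_gt0 e0 (@ltr0n R 2)).
  by rewrite add0r => le; exists l; rewrite [ltRHS]splitr ltrD.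
have [e e0|z hz] := comp (x \o s).
  have [l le] := small e e0.
  near=> a b => /=; apply: lt_trans le; apply: (@close l); apply: hs.
  - by near: a; exact: nbhs_infty_ge.
  - by near: b; exact: nbhs_infty_ge.
exists z => A; rewrite ind => -[e /= e0 eA].
have e20 : 0 < e / 2 by rewrite divr_gt0.
have [l le] := small _ e20.
have [N _ hN] := hz _ (metric_ball_nbhs z ind e20).
(* For almost every [m] along [F], [x m] shares the selected ball of scale [l] with a term of
   [x \o s] that is close to [z]. *)
change (F (x @^-1` A)); apply: filterS (hi l) => m /= hm; apply: eA => /=.
rewrite [ltRHS]splitr; apply: le_lt_trans (tri _ (x (s (maxn N l))) _) _.
apply: ltrD; first by apply: hN => /=; exact: leq_maxl.
by apply: lt_trans le; apply: close => //; apply: hs; exact: leq_maxr.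
Unshelve. all: by end_near. Qed.

(** By density the union of the first [n] balls of a fixed scale increases to the whole space. At
    scale [l] enough balls are taken to miss mass less than [e / 2 ^ l.+1], and these losses sum to
    at most [e]. *)
Lemma ulam_totally_bounded (R : realType) (T : ptopologicalType)
    (d : T -> T -> R) (p : nat -> T) (mu : probability (borel T) R) (e : R) :
  is_metric d -> induces_topology d ->
  (forall x r, 0 < r -> exists n, d (p n) x < r) -> 0 < e ->
  exists2 n : nat -> nat, measurable (finitely_covered d p n : set (borel T)) &
    (mu (~` finitely_covered d p n) <= e%:E)%E.
Proof.
move=> md ind hp e0.
pose B l n : set (borel T) := [set x | exists2 i, (i < n)%N & d (p i) x < l.+1%:R^-1].
have mB l n : measurable (B l n).
  rewrite (_ : B l n = \bigcup_(i in `I_n) [set x | d (p i) x < l.+1%:R^-1]) //.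
  apply: bigcup_measurable => i _; apply: sub_sigma_algebra.
  exact: metric_ball_open.
have /choice[n hn] : forall l, exists n,
    (mu (~` B l n) < (e / (2 ^ l.+1)%:R)%:E)%E.
  move=> l; pose C n := ~` B l n.
  have mC n : measurable (C n) by exact: measurableC.
  have C0 : \bigcap_n C n = set0.
    apply/seteqP; split=> // x h.
    have [|i xi] := hp x l.+1%:R^-1; first by rewrite invr_gt0.
    by have := h i.+1 Logic.I; apply; exists i.
  have hC : (mu \o C) x @[x --> \oo] --> mu (\bigcap_n C n).
    apply: nonincreasing_cvg_mu => //.
    - by rewrite -ge0_fin_numE// fin_num_measure.
    - by rewrite C0.
    - move=> a b ab; apply/subsetPset/subsetC => x [i ia xi].
      by exists i => //; exact: leq_trans ab.
  have [|k _ hk] := hC [set y | (y < (e / (2 ^ l.+1)%:R)%:E)%E].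
    apply: open_nbhs_nbhs; split; first exact: open_ereal_lt_ereal.
    by rewrite C0 /= measure0 lte_fin divr_gt0// ltr0n expn_gt0.
  by exists k; exact: (hk k (leqnn k)).
have GE : finitely_covered d p n = \bigcap_l B l (n l).
  by apply/seteqP; split=> x /= h l => [_|]; [exact: h|exact: (h l Logic.I)].
exists n; rewrite GE; first exact: bigcapT_measurable.
rewrite setC_bigcap; have mBC l : measurable (~` B l (n l)) by exact: measurableC.
apply: le_trans (generalized_Boole_inequality mu mBC (bigcupT_measurable _ mBC)) _.
apply: le_trans (epsilon_trick0 xpredT (ltW e0)).
by apply: lee_nneseries => // l _; exact/ltW/hn.
Qed.

(** The label of a point records whether it lies in the totally bounded set [G k] and which of
    finitely many balls of one small radius contain it. Good labels are those of points of [G k]; a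
    point with the same label then shares a ball with it. *)
Lemma exists_fine_labels (R : realType) (K : nat)
    (X : 'I_K -> ptopologicalType) (mu : forall k, probability (borel (X k)) R)
    (c : prod_topology X -> R) (e delta : R) :
  (forall k, polish R (X k)) -> continuous c -> 0 < e -> 0 < delta ->
  exists (L : finType) (lab : forall k, borel (X k) -> L) (good : pred L),
    [/\ forall k j, measurable (lab k @^-1` [set j]),
        forall k, (mu k (lab k @^-1` [set j | ~~ good j]) <= delta%:E)%E &
        forall x y : prod_topology X,
          (forall k, lab k (x k) = lab k (y k)) ->
          (forall k, good (lab k (x k))) -> `|c x - c y| <= e].
Proof.
move=> hX cc e0 delta0.
have /forall_exists_fun[d hd] : forall k, exists d : X k -> X k -> R,
    [/\ is_metric d, induces_topology d & is_complete_metric d].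
  by move=> k; have [] := hX k.
have md k : is_metric (d k) by have [] := hd k.
have ind k : induces_topology (d k) by have [] := hd k.
have /forall_exists_fun[p hp] : forall k, exists p : nat -> X k,
    forall x r, 0 < r -> exists n, d k (p n) x < r.
  move=> k; have [s _] := hX k.
  exact: separable_dense_seq s (md k) (ind k).
have /forall_exists_fun[n hn] : forall k, exists n : nat -> nat,
    measurable (finitely_covered (d k) (p k) n : set (borel (X k))) /\
    (mu k (~` finitely_covered (d k) (p k) n) <= delta%:E)%E.
  move=> k; have [n ? ?] := ulam_totally_bounded (mu k) (md k) (ind k) (hp k) delta0.
  by exists n.
pose G k : set (borel (X k)) := finitely_covered (d k) (p k) (n k).
have [m hm] : exists m : nat, forall x y : prod_topology X,
    (forall k, G k (x k)) ->
    (forall k, exists2 i, (i < n k m)%N &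
       d k (p k i) (x k) < m.+1%:R^-1 /\ d k (p k i) (y k) < m.+1%:R^-1) ->
    `|c x - c y| <= e.
  apply: contrapT => /forallNP hN.
  have /choice[xy hxy] : forall m, exists xy : prod_topology X * prod_topology X,
      [/\ forall k, G k (xy.1 k),
          forall k, exists2 i, (i < n k m)%N &
            d k (p k i) (xy.1 k) < m.+1%:R^-1 /\ d k (p k i) (xy.2 k) < m.+1%:R^-1 &
          e < `|c xy.1 - c xy.2|].
    move=> m; apply: contrapT => hxy; apply: (hN m) => x y Gx hk.
    by rewrite leNgt; apply/negP => exy; apply: hxy; exists (x, y).
  (* An ultrafilter refining the tails: it makes the points in [G k] converge, and it still lets the
     radius [m.+1%:R^-1] tend to zero. *)
  have [F [FU oF]] := ultraFilterLemma (@eventually_filter).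
  have /forall_exists_fun[z hz] : forall k, exists z : X k, (fun m => (xy m).1 k) @ F --> z.
    move=> k; have [mk ik ck] := hd k.
    apply: (ultra_totally_bounded_cvg (p := p k) (n := n k) mk ik ck FU) => m.
    by have [+ _ _] := hxy m; exact.
  have cx : (fun m => (xy m).1) @ F --> (z : prod_topology X).
    exact: (@cvg_prod_topology _ X (fmap (fun m => (xy m).1) F) z).
  (* The second points have the same limit because they stay within [2 / m.+1] of the first in each
     coordinate. *)
  have cy : (fun m => (xy m).2) @ F --> (z : prod_topology X).
    apply: (@cvg_prod_topology _ X (fmap (fun m => (xy m).2) F) z) => k A.
    rewrite ind => -[r /= r0 rA].
    have r20 : 0 < r / 2 by rewrite divr_gt0.
    have h1 : F [set m | d k (z k) ((xy m).1 k) < r / 2].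
      exact: (hz k _ (metric_ball_nbhs (z k) (ind k) r20)).
    have r40 : 0 < r / 2 / 2 by rewrite divr_gt0.
    have [N] := ltr_add_invr r40; rewrite add0r => hN4.
    have h2 : F [set m | (N <= m)%N] by apply: oF; exists N.
    change (F [set m | A ((xy m).2 k)]).
    apply: filterS2 h1 h2 => m /= h1 h2; apply: rA => /=.
    have [_ sym tri] := md k; have [_ + _] := hxy m => /(_ k)[i _ [hx hy]].
    have mN : m.+1%:R^-1 < r / 2 / 2.
      by apply: le_lt_trans hN4; rewrite lef_pV2 ?posrE// ler_nat.
    rewrite [ltRHS]splitr; apply: le_lt_trans (tri _ ((xy m).1 k) _) _.
    apply: ltrD => //; rewrite [ltRHS]splitr.
    apply: le_lt_trans (tri _ (p k i) _) _; apply: ltrD.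
      by rewrite sym; exact: lt_trans mN.
    exact: lt_trans mN.
  have e20 : 0 < e / 2 by rewrite divr_gt0.
  have h1 : F [set m | `|c z - c (xy m).1| < e / 2].
    have /cvgrPdist_lt : (fun m => c (xy m).1) @ F --> c z := cvg_comp _ _ cx (cc z).
    by apply.
  have h2 : F [set m | `|c z - c (xy m).2| < e / 2].
    have /cvgrPdist_lt : (fun m => c (xy m).2) @ F --> c z := cvg_comp _ _ cy (cc z).
    by apply.
  have [m [/= h1m h2m]] := filter_ex (filterI h1 h2).
  have [_ _] := hxy m; apply/negP; rewrite -leNgt [leRHS]splitr.
  rewrite -(subrKA (c z)) (le_trans (ler_normD _ _))// lerD ?ltW//.
  by rewrite distrC.
(* One bound for all coordinates, so that all labels live in the same finite type. *)
pose N := \max_k n k m.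
pose b k i : set (borel (X k)) := [set x | d k (p k i) x < m.+1%:R^-1].
pose lab k (x : borel (X k)) : bool * {ffun 'I_N -> bool} :=
  (`[< G k x >], [ffun i : 'I_N => `[< b k i x >]]).
exists (bool * {ffun 'I_N -> bool})%type, lab, fst; split.
- move=> k [gj fj].
  have mb (B : set (borel (X k))) (t : bool) : measurable B ->
      measurable [set x | `[< B x >] = t].
    move=> mB; case: t.
      rewrite (_ : mkset _ = B)//.
      by apply/seteqP; split=> x /= => [/asboolP|/asboolP].
    rewrite (_ : mkset _ = ~` B); first exact: measurableC.
    by apply/seteqP; split=> x /= => [/asboolPn|/asboolPn/negbTE].
  rewrite (_ : _ @^-1` _ = [set x | `[< G k x >] = gj] `&`
      \bigcap_(i in [set: 'I_N]) [set x | `[< b k i x >] = fj i]).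
    apply: measurableI; first by apply: mb; have [] := hn k.
    apply: fin_bigcap_measurable => // i _; apply: mb.
    by apply: sub_sigma_algebra; exact: metric_ball_open (md k) (ind k).
  apply/seteqP; split=> x /=.
    by move=> [<- <-]; split=> // i _ /=; rewrite ffunE.
  move=> [Gx bx]; rewrite /lab Gx; congr (_, _).
  by apply/ffunP => i; rewrite ffunE; exact: bx.
- move=> k; rewrite (_ : _ @^-1` _ = ~` G k); first by have [] := hn k.
  by apply/seteqP; split=> x /= => /asboolPn.
- move=> x y hxy gx; apply: hm => k; first by have := gx k => /= /asboolP.
  have /= /asboolP Gx := gx k; have [i ilt hi] := Gx m; exists i => //.
  split=> //.
  have iN : (i < N)%N by apply: leq_trans ilt _; exact: (leq_bigmax k).
  have := hxy k; rewrite /lab => -[_ /ffunP/(_ (Ordinal iN))].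
  by rewrite !ffunE /= => eb; apply/asboolP; rewrite -eb; exact/asboolP.
Qed.

(** * Couplings with prescribed cell masses *)

Lemma exists_pushforward_probability (R : realType) d d' (T : measurableType d)
    (T' : measurableType d') (P : probability T R) (f : T -> T') :
  measurable_fun [set: T] f ->
  exists Q : probability T' R, forall A, Q A = P (f @^-1` A).
Proof.
move=> mf; pose X : {mfun T >-> T'} := HB.pack f (isMeasurableFun.Build _ _ _ _ _ mf).
by exists (distribution P X).
Qed.

Lemma exists_mixture_probability (R : realType) d (T : measurableType d)
    (I : finType) (g : I -> R) (P : I -> probability T R) :
  (forall i, 0 <= g i) -> \sum_i g i = 1 ->
  exists Q : probability T R, forall A, Q A = (\sum_i (g i)%:E * P i A)%E.
Proof.
move=> g0 g1.
(* [msum] runs over natural numbers, so [I] is enumerated and the measure is zero past its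
   cardinal. *)
pose m (k : nat) : {measure set T -> \bar R} :=
  if insub k is Some o then
    mscale (NngNum (g0 (enum_val (o : 'I_#|I|)))) (P (enum_val o))
  else mzero.
have mE A : msum m #|I| A = (\sum_i (g i)%:E * P i A)%E.
  rewrite /msum [RHS](reindex (@enum_val I predT)) /=; last first.
    exact: onW_bij (enum_val_bij I).
  by apply: eq_bigr => o _; rewrite /m valK.
have m1 : msum m #|I| setT = 1%E.
  rewrite mE; under eq_bigr do rewrite probability_setT mule1.
  by rewrite sumEFin g1.
pose Q : probability T R :=
  HB.pack (msum m #|I|) (Measure_isProbability.Build _ _ _ (msum m #|I|) m1).
by exists Q => A; exact: mE.
Qed.

(** The product form also covers a null set [A], where [mnormalize] falls back on [P] itself. *)
Lemma exists_conditional_probability (R : realType) d (T : measurableType d)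
    (P : probability T R) (A : set T) :
  measurable A ->
  exists Q : probability T R,
    forall B, measurable B -> (P (B `&` A) = P A * Q B)%E.
Proof.
move=> mA; exists (mnormalize (mrestr P mA) P) => B mB.
rewrite /= /mnormalize /= /mrestr setTI.
case: ifPn => [/orP[/eqP PA0|/eqP PAoo]|].
- rewrite PA0 mul0e; apply: (subset_measure0 _ _ _ PA0) => //.
  exact: measurableI.
- by have := probability_le1 P mA; rewrite PAoo leye_eq.
rewrite negb_or => /andP[PA0 _].
have PAfin : P A \is a fin_num by exact: fin_num_measure.
rewrite muleC -muleA -[X in (_ * (_ * X))%E](fineK PAfin) -EFinM.
by rewrite mulVf ?mule1// fine_eq0.
Qed.

Lemma integrable_of_bounded (R : realType) d (T : measurableType d)
    (P : probability T R) (f : T -> R) (M : R) :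
  measurable_fun setT f -> (forall x, `|f x| <= M) ->
  P.-integrable setT (EFin \o f).
Proof.
move=> mf fM; apply: measurable_bounded_integrable => //.
  by rewrite [X in (X < _)%E](probability_setT P) ltry.
by exists M; split; [exact: num_real|move=> y My x _ /=; exact: le_trans (ltW My)].
Qed.

Section finite_label.
Variables (R : realType) (d : measure_display) (T : measurableType d).
Variables (P : probability T R) (I : finType) (l : T -> I).
Hypothesis ml : forall i, measurable (l @^-1` [set i]).

Lemma finite_label_measurable (h : I -> R) : measurable_fun setT (h \o l).
Proof.
move=> _ Y mY; rewrite setTI.
rewrite (_ : _ @^-1` _ = \bigcup_(i in [set i | Y (h i)]) l @^-1` [set i]).
  by apply: fin_bigcup_measurable => // i _; exact: ml.
by apply/seteqP; split=> [x Yx|x [i /= Yi li]]; [exists (l x)|rewrite /= li].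
Qed.

Lemma finite_label_integrable (h : I -> R) :
  P.-integrable setT (EFin \o (h \o l)).
Proof.
apply: (@integrable_of_bounded _ _ _ _ _ (\sum_i `|h i|)).
  exact: finite_label_measurable.
by move=> x /=; rewrite (bigD1 (l x))//= lerDl sumr_ge0.
Qed.

Lemma integral_finite_label (h : I -> R) :
  (\int[P]_x (h (l x))%:E = \sum_i (h i)%:E * P (l @^-1` [set i]))%E.
Proof.
transitivity (\int[P]_x \sum_i ((h i)%:E * (\1_(l @^-1` [set i]) x)%:E))%E.
  apply: eq_integral => x _; rewrite (bigD1 (l x))//= big1 ?adde0.
    by rewrite indicE mem_set// mule1.
  by move=> i il; rewrite indicE memNset ?mule0//= => li; rewrite li eqxx in il.
rewrite integral_sum//; last first.
  by move=> i; apply: integrableZl => //; exact: integrable_indic.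
apply: eq_bigr => i _; rewrite integralZl//; last exact: integrable_indic.
by rewrite integral_indic// setIT.
Qed.

End finite_label.

(** Start from a Dirac mass and, one coordinate after another, overwrite coordinate [j] by an
    independent variable of law [nu j]. This fixes marginal [j] and keeps the earlier ones. *)
Lemma couplings_nonempty (R : realType) (K : nat) (X : 'I_K -> ptopologicalType)
    (nu : forall k, probability (borel (X k)) R) :
  (forall k, polish R (X k)) -> exists pi, couplings nu pi.
Proof.
move=> hX.
suff H j : (j <= K)%N -> exists pi : probability (borel (prod_topology X)) R,
    forall k : 'I_K, (k < j)%N -> forall A : set (borel (X k)), measurable A ->
      pi ((fun x => x k) @^-1` A) = nu k A.
  by have [pi hpi] := H K (leqnn K); exists pi => k A mA; exact: hpi.
elim: j => [_|j IH jK]; first by exists (dirac point).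
have [pi hpi] := IH (ltnW jK); pose j0 := Ordinal jK.
pose f (z : borel (prod_topology X) * borel (X j0)) : borel (prod_topology X) :=
  dfwith z.1 j0 z.2.
have fin z : f z j0 = z.2 by rewrite /f dfwithin.
have fout z k : k != j0 -> f z k = z.1 k by move=> kj; rewrite /f dfwithout// eq_sym.
have [|Q hQ] := @exists_pushforward_probability R _ _ _ _
    (pi \x nu j0)%E f.
  apply: (measurable_fun_prod hX) => k.
  have [->|kj] := eqVneq k j0.
    by apply: eq_measurable_fun measurable_snd => z _; rewrite fin.
  apply: (eq_measurable_fun (fun z : borel (prod_topology X) * borel (X j0) =>
    z.1 k : borel (X k))) => [z _|].
    by rewrite fout.
  have := measurableT_comp (@measurable_fun_proj _ X k)
    (@measurable_fst _ _ (borel (prod_topology X)) (borel (X j0))).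
  exact.
exists Q => k; rewrite ltnS leq_eqVlt => /predU1P[kj A mA|kj A mA].
  have {}kj : k = j0 by apply: val_inj.
  subst k; rewrite hQ (_ : _ @^-1` _ = setT `*` A).
    apply: etrans (product_measure1E pi (nu j0) measurableT mA) _.
    by rewrite [X in (X * _)%E](probability_setT pi) mul1e.
  by apply/seteqP; split=> z /=; rewrite fin => //; case.
have kNj : k != j0 by apply: contraTneq kj => ->; rewrite ltnn.
rewrite hQ (_ : _ @^-1` _ = ((fun x => x k) @^-1` A) `*` setT).
  have mpA : measurable ((fun x : borel (prod_topology X) => x k : borel (X k)) @^-1` A).
    by rewrite -[X in measurable X]setTI; exact: measurable_fun_proj.
  apply: etrans (product_measure1E pi (nu j0) mpA measurableT) _.
  by rewrite [X in (_ * X)%E](probability_setT (nu j0)) mule1; exact: hpi.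
by apply/seteqP; split=> z /=; rewrite fout => //; case.
Qed.

Lemma measure_label_partition (R : realType) d (T : measurableType d)
    (P : probability T R) (I : finType) (l : T -> I) (A : set T) :
  (forall i, measurable (l @^-1` [set i])) -> measurable A ->
  (P A = \sum_i P (A `&` l @^-1` [set i]))%E.
Proof.
move=> ml mA; have mAl i : measurable (A `&` l @^-1` [set i]).
  exact: measurableI.
rewrite -[A in LHS]setIT -integral_indic//.
transitivity (\int[P]_x \sum_i (\1_(A `&` l @^-1` [set i]) x)%:E)%E.
  apply: eq_integral => x _; rewrite (bigD1 (l x))//= big1 ?adde0.
    by rewrite !indicE in_setI [X in _ && X]mem_set// andbT.
  by move=> i il; rewrite indicE memNset// => -[_ /= li]; rewrite li eqxx in il.
rewrite integral_sum//; last by move=> i; exact: integrable_indic.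
by apply: eq_bigr => i _; rewrite integral_indic// setIT.
Qed.

Lemma measurable_cell (K : nat) (X : 'I_K -> ptopologicalType) (L : Type)
    (lab : forall k, borel (X k) -> L) (w : 'I_K -> L) :
  (forall k j, measurable (lab k @^-1` [set j])) ->
  measurable [set x : borel (prod_topology X) | forall k, lab k (x k) = w k].
Proof.
move=> mlab; rewrite (_ : mkset _ =
    \bigcap_k ((fun x => x k : borel (X k)) @^-1` (lab k @^-1` [set w k]))).
  apply: fin_bigcap_measurable => // k _; rewrite -[X in measurable X]setTI.
  by apply: measurable_fun_proj.
by apply/seteqP; split=> x /= h k => [_|]; [exact: h|exact: (h k Logic.I)].
Qed.

(* Spread each atom of [g] over its cell by a coupling of the conditional
   laws given the labels. *)
Lemma exists_coupling_with_labels (R : realType) (K : nat)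
    (X : 'I_K -> ptopologicalType) (mu : forall k, probability (borel (X k)) R)
    (L : finType) (lab : forall k, borel (X k) -> L)
    (g : {ffun 'I_K -> L} -> R) :
  (forall k, polish R (X k)) ->
  (forall k j, measurable (lab k @^-1` [set j])) ->
  (forall w, 0 <= g w) -> \sum_w g w = 1 ->
  (forall k j, (\sum_(w : {ffun 'I_K -> L} | w k == j) g w)%:E =
     mu k (lab k @^-1` [set j])) ->
  exists2 pi, couplings mu pi & forall w : {ffun 'I_K -> L},
    (pi [set x | forall k, lab k (x k) = w k] <= (g w)%:E)%E.
Proof.
move=> hX mlab g0 g1 gmu.
have /forall_exists_fun[nu hnu] : forall k,
    exists q : L -> probability (borel (X k)) R,
    forall j (B : set (borel (X k))), measurable B ->
      (mu k (B `&` lab k @^-1` [set j]) = mu k (lab k @^-1` [set j]) * q j B)%E.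
  move=> k; suff /choice[q hq] : forall j, exists Q : probability (borel (X k)) R,
      forall B : set (borel (X k)), measurable B ->
        (mu k (B `&` lab k @^-1` [set j]) = mu k (lab k @^-1` [set j]) * Q B)%E.
    by exists q.
  by move=> j; exact: exists_conditional_probability.
have [rho hrho] := forall_exists_fun (fun w : {ffun 'I_K -> L} =>
  couplings_nonempty (fun k => nu k (w k)) hX).
have [pi hpi] := exists_mixture_probability rho g0 g1.
exists pi => [k A mA|w].
  rewrite /pushforward hpi (measure_label_partition (mu k) (mlab k) mA).
  under eq_bigr do rewrite [X in (_ * X)%E](hrho _ k A mA).
  (* Grouping the cells by their label in coordinate [k] reduces the marginal to the law of total
     probability for [mu k]. *)
  rewrite (partition_big (fun w : {ffun 'I_K -> L} => w k) predT)//=.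
  apply: eq_bigr => j _; rewrite hnu// -gmu -sumEFin ge0_sume_distrl//.
    by apply: eq_bigr => w /eqP <-.
  by move=> w _; rewrite lee_fin.
rewrite hpi (bigD1 w)//= big1 ?adde0.
  rewrite -[leRHS]mule1 lee_wpmul2l ?lee_fin//; apply: probability_le1.
  exact: measurable_cell.
move=> v vw.
have [k vkw] : exists k, v k != w k.
  by apply/existsP; apply: contraNT vw => /existsPn h; apply/eqP/ffunP => k;
    apply/eqP; rewrite -[_ == _]negbK.
(* If [g v > 0], the cell of label [v k] has positive mass, so its conditional law does not charge
   the disjoint cell of label [w k]. *)
have [gv0|gv0] := eqVneq (g v) 0; first by rewrite gv0 mul0e.
suff nu0 : nu k (v k) (lab k @^-1` [set w k]) = 0%E.
  rewrite (_ : rho v _ = 0%E) ?mule0//.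
  apply/eqP; rewrite eq_le measure_ge0 andbT -nu0 -(hrho v k)//.
  apply: le_measure; rewrite ?inE; first exact: measurable_cell.
    by rewrite -[X in measurable X]setTI; exact: measurable_fun_proj.
  by move=> x /(_ k).
have := hnu k (v k) (lab k @^-1` [set w k]) (mlab k _).
rewrite (_ : _ `&` _ = set0); last first.
  by apply/seteqP; split=> // x [/= -> wv]; rewrite wv eqxx in vkw.
rewrite measure0 => /esym/eqP; rewrite mule_eq0 => /orP[|/eqP//].
rewrite -gmu eqe psumr_eq0 => [|u _]; last exact: g0.
by move=> /allP/(_ v); rewrite mem_index_enum eqxx /= (negbTE gv0) => /(_ isT).
Qed.

(** * Duality *)

(** Change of variables when the image law is known only through its values on measurable sets, as
    for the marginals of a coupling. *)
Lemma integral_image_law (R : realType) d d' (T : measurableType d)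
    (T' : measurableType d') (P : probability T R) (Q : probability T' R)
    (phi : T -> T') (f : T' -> R) :
  measurable_fun [set: T] phi ->
  (forall A, measurable A -> P (phi @^-1` A) = Q A) ->
  Q.-integrable [set: T'] (EFin \o f) ->
  P.-integrable [set: T] (fun x => (f (phi x))%:E) /\
  (\int[P]_x (f (phi x))%:E = \int[Q]_y (f y)%:E)%E.
Proof.
move=> mphi PQ intf.
pose X : {mfun T >-> T'} := HB.pack phi (isMeasurableFun.Build _ _ _ _ _ mphi).
have QE (h : T' -> \bar R) : (\int[Q]_y h y = \int[distribution P X]_y h y)%E.
  apply: eq_measure_integral => A mA _; exact/esym/PQ.
have mf := measurable_int _ intf.
have intfphi : P.-integrable setT (fun x => (f (phi x))%:E).
  apply/integrableP; split; first exact: (measurableT_comp mf mphi).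
  have /integrableP[_] := intf; rewrite QE ge0_integral_distribution//.
  exact: measurableT_comp.
by split=> //; rewrite QE integral_distribution.
Qed.

Lemma weak_duality (R : realType) (K : nat) (X : 'I_K -> ptopologicalType)
    (mu : forall k, probability (borel (X k)) R) (c : prod_topology X -> R)
    (f : forall k, X k -> R) pi :
  bounded_fun c -> continuous c -> couplings mu pi -> admissible c mu f ->
  (dual_value mu f <= transport_cost c pi)%E.
Proof.
move=> [M [_ cM]] cc hpi [mf intf fc].
have h k := integral_image_law (@measurable_fun_proj _ X k) (hpi k) (intf k).
rewrite /dual_value; under eq_bigr do rewrite -(h _).2.
rewrite -integral_sum//; last by move=> k; exact: (h k).1.
apply: le_integral => //.
- by apply: integrable_sum => // k _; exact: (h k).1.
- apply: (@integrable_of_bounded _ _ _ _ _ (M + 1)) => [|x].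
    exact: continuous_measurable_borel.
  by apply: cM => //; rewrite ltrDl.
- by move=> x _; rewrite sumEFin lee_fin.
Qed.

Lemma strong_duality (R : realType) (K : nat) (X : 'I_K -> ptopologicalType)
    (mu : forall k, probability (borel (X k)) R) (c : prod_topology X -> R)
    (S eta : R) :
  (0 < K)%N -> (forall k, polish R (X k)) -> bounded_fun c -> continuous c ->
  (forall f, admissible c mu f -> (dual_value mu f <= S%:E)%E) -> 0 < eta ->
  exists2 pi, couplings mu pi & (transport_cost c pi <= (S + eta)%:E)%E.
Proof.
move=> K0 hX [M0 [_ cM0]] cc dualS eta0.
pose M := `|M0| + 1.
have cM x : `|c x| <= M.
  by apply: cM0 => //; rewrite ltr_pwDr// ler_norm.
have M_ge0 : 0 <= M by rewrite addr_ge0.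
(* Error budget: [2 * e] for the oscillation on good cells, and [2 * B * (K * delta) = 2 * e] for
   cells with a bad coordinate. *)
pose e := eta / 4; have e0 : 0 < e by rewrite divr_gt0.
pose B := M + e; have B0 : 0 < B by rewrite ltr_wpDl.
pose delta := e / (B * K%:R).
have KR : 0 < K%:R :> R by rewrite ltr0n.
have delta0 : 0 < delta by rewrite divr_gt0// mulr_gt0.
have [L [lab [good [mlab bad fine_lab]]]] := exists_fine_labels mu hX cc e0 delta0.
pose cell k j : set (borel (X k)) := lab k @^-1` [set j].
pose p k j := fine (mu k (cell k j)).
have pE k j : (p k j)%:E = mu k (cell k j).
  by rewrite fineK// fin_num_measure//; exact: mlab.
have p1 k : \sum_j p k j = 1.
  apply: EFin_inj; rewrite -sumEFin -(probability_setT (mu k)).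
  rewrite (measure_label_partition (mu k) (mlab k) measurableT).
  by apply: eq_bigr => j _; rewrite setTI.
(* Empty cells receive the default [point]; comparisons with [c x] use only [rep (l x)], whose cells
   contain the coordinates of [x]. *)
pose rep (w : {ffun 'I_K -> L}) : prod_topology X := fun k => xget point (cell k (w k)).
(* Below [c] everywhere, and within [2 * e] of it on good cells. *)
pose C (w : {ffun 'I_K -> L}) : R :=
  if [forall k, good (w k)] then c (rep w) - e else - B.
pose l (x : borel (prod_topology X)) : {ffun 'I_K -> L} := [ffun k => lab k (x k)].
have repE x k : lab k (rep (l x) k) = lab k (x k).
  by rewrite /rep ffunE; case: xgetP => [y _|h]; [|case: (h (x k))].
have cB x : - B <= c x - e.
  by have := cM x; rewrite ler_norml /B => /andP[h _]; lra.
have CB w : - B <= C w.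
  by rewrite /C; case: ifP.
have crep x : [forall k, good (l x k)] -> `|c (rep (l x)) - c x| <= e.
  move=> /forallP gx; apply: fine_lab => k; rewrite repE//.
  by have := gx k; rewrite ffunE.
have Cc x : C (l x) <= c x.
  rewrite /C; case: ifP => [/crep|_].
    by rewrite ler_norml => /andP[_ h]; lra.
  by apply: le_trans (cB x) _; rewrite lerBlDr lerDl ltW.
(* Counting bad coordinates, rather than testing for one, gives a sum over [k] whose mean depends
   only on the marginals. *)
pose nbad (w : {ffun 'I_K -> L}) : R := \sum_k (~~ good (w k))%:R.
have nbad0 w : 0 <= nbad w by apply: sumr_ge0.
have cC x : c x <= C (l x) + 2 * e + 2 * B * nbad (l x).
  rewrite /C; case: ifPn => [/crep|].
    have := nbad0 (l x); move: (nbad _) => b b0; rewrite ler_norml => /andP[h _].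
    have : 0 <= 2 * B * b by rewrite !mulr_ge0// ltW.
    by lra.
  move=> /forallPn[k gk].
  have b1 : 1 <= nbad (l x).
    by rewrite /nbad (bigD1 k)//= gk lerDl sumr_ge0.
  have : 2 * B <= 2 * B * nbad (l x) by rewrite ler_peMr// mulr_ge0// ltW.
  have := cM x; rewrite ler_norml => /andP[_]; rewrite /B; lra.
have [|g [g0 gp gC]] := @finite_multimarginal_duality R K L p C B S K0 p1 CB.
  (* A feasible [psi] gives the step functions [psi k \o lab k], admissible because
     [C (l x) <= c x]. *)
  move=> psi psiC; pose f k (x : X k) := psi k (lab k x); rewrite -lee_fin.
  have <- : dual_value mu f = (\sum_k \sum_j psi k j * p k j)%:E.
    rewrite -sumEFin; apply: eq_bigr => k _; rewrite -sumEFin.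
    rewrite (integral_finite_label (mu k) (mlab k) (psi k)).
    by apply: eq_bigr => j _; rewrite EFinM pE.
  apply: dualS; split=> [k|k|x].
  - exact: finite_label_measurable (mlab k) (psi k).
  - exact: finite_label_integrable (mlab k) (psi k).
  - apply: le_trans (Cc x); apply: le_trans (psiC (l x)).
    by apply: ler_sum => k _; rewrite ffunE.
have g1 : \sum_w g w = 1.
  pose k0 := Ordinal K0; rewrite -(p1 k0).
  rewrite (partition_big (fun w : {ffun 'I_K -> L} => w k0) predT)//=.
  by apply: eq_bigr => j _; exact: gp.
have [pi hpi pig] : exists2 pi, couplings mu pi & forall w : {ffun 'I_K -> L},
    (pi [set x | forall k, lab k (x k) = w k] <= (g w)%:E)%E.
  apply: exists_coupling_with_labels => // k j.
  by rewrite gp pE.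
exists pi => //.
(* By [cC], [h \o l] is a majorant of [c] constant on cells, so its integral is a finite sum. *)
pose h w := C w + 2 * e + 2 * B * nbad w.
have lE w : l @^-1` [set w] = [set x | forall k, lab k (x k) = w k].
  apply/seteqP; split=> x /= => [<- k|xw]; first by rewrite ffunE.
  by apply/ffunP => k; rewrite ffunE.
have ml w : measurable (l @^-1` [set w]) by rewrite lE; exact: measurable_cell.
pose P w := fine (pi (l @^-1` [set w])).
have PE w : (P w)%:E = pi (l @^-1` [set w]).
  by rewrite fineK// fin_num_measure.
have P1 : \sum_w P w = 1.
  apply: EFin_inj; rewrite -sumEFin -(probability_setT pi).
  rewrite (measure_label_partition pi ml measurableT).
  by apply: eq_bigr => w _; rewrite setTI.
have Pg w : P w <= g w by rewrite -lee_fin PE lE.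
have badE k : \sum_j (~~ good j)%:R * p k j <= delta.
  rewrite -lee_fin; apply: le_trans (bad k); rewrite -sumEFin.
  have mbad : measurable (lab k @^-1` [set j | ~~ good j]).
    rewrite (_ : _ @^-1` _ = \bigcup_(j in [set j | ~~ good j]) cell k j).
      by apply: fin_bigcup_measurable => // j _; exact: mlab.
    by apply/seteqP; split=> [x /= gx|x [j /= gj xj]]; [exists (lab k x)|rewrite /= xj].
  rewrite (measure_label_partition (mu k) (mlab k) mbad).
  apply: lee_sum => j _; rewrite EFinM pE; have [gj|gj] := boolP (good j).
    by rewrite mul0e measure_ge0.
  rewrite mul1e (_ : _ `&` _ = cell k j)//.
  by apply/seteqP; split=> [x [_ //]|x /= xj]; split=> //; rewrite /= xj.
have nbadE : \sum_w g w * nbad w <= K%:R * delta.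
  rewrite (eq_bigr
    (fun w : {ffun 'I_K -> L} => \sum_k (~~ good (w k))%:R * g w)); last first.
    by move=> w _; rewrite mulrC /nbad mulr_suml.
  rewrite exchange_big/= mulr_natl -[X in _ *+ X]card_ord -sumr_const.
  apply: ler_sum => k _; apply: le_trans (badE k).
  rewrite (partition_big (fun w : {ffun 'I_K -> L} => w k) predT)//=.
  apply: ler_sum => j _; rewrite -gp mulr_sumr.
  by apply: ler_sum => w /eqP ->.
have hg : \sum_w h w * g w <= S + eta.
  have -> : \sum_w h w * g w =
      \sum_w g w * C w + 2 * e + 2 * B * \sum_w g w * nbad w.
    rewrite [X in _ + X + _](_ : _ = \sum_w 2 * e * g w); last first.
      by rewrite -mulr_sumr g1 mulr1.
    rewrite mulr_sumr -!big_split/=.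
    by apply: eq_bigr => w _; rewrite /h; ring.
  have : 2 * B * (\sum_w g w * nbad w) <= 2 * B * (K%:R * delta).
    by rewrite ler_wpM2l// mulr_ge0// ltW.
  have -> : 2 * B * (K%:R * delta) = 2 * e.
    by rewrite /delta; field; rewrite !gt_eqF.
  have -> : eta = 4 * e by rewrite /e; field.
  by move: gC; lra.
(* [P <= g] with equal total masses, and [h + B >= 0]: shifting by [B] makes the comparison termwise
   and leaves the difference of the sums unchanged. *)
have hP : \sum_w h w * P w <= \sum_w h w * g w.
  have -> : \sum_w h w * g w = \sum_w h w * P w +
      \sum_w (h w + B) * (g w - P w) - B * \sum_w (g w - P w).
    rewrite mulr_sumr -big_split/= -sumrB.
    by apply: eq_bigr => w _; ring.
  rewrite sumrB g1 P1 subrr mulr0 subr0.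
  rewrite lerDl; apply: sumr_ge0 => w _.
  rewrite mulr_ge0 ?subr_ge0// /h.
  have : 0 <= 2 * B * nbad w by rewrite !mulr_ge0// ltW.
  by have := CB w; lra.
apply: le_trans (_ : (\int[pi]_x (h (l x))%:E <= _)%E).
  apply: le_integral => //.
  - apply: (@integrable_of_bounded _ _ _ pi c M) => //.
    exact: continuous_measurable_borel.
  - exact: (finite_label_integrable pi ml h).
  - by move=> x _; rewrite lee_fin; exact: cC.
rewrite (integral_finite_label pi ml h); under eq_bigr do rewrite -PE -EFinM.
by rewrite sumEFin lee_fin (le_trans hP).
Qed.

Theorem theorem2 (R : realType) (K : nat) (hK : (3 <= K)%N)
    (X : 'I_K -> ptopologicalType) (hX : forall k, polish R (X k))
    (mu : forall k, probability (borel (X k)) R)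
    (c : prod_topology X -> R)
    (hcb : bounded_fun c) (hcc : continuous c) :
  MOT c mu = ereal_sup [set dual_value mu f | f in admissible c mu].
Proof.
have K0 : (0 < K)%N by exact: leq_trans hK.
apply/eqP; rewrite eq_le; apply/andP; split; last first.
  apply: ub_ereal_sup => _ [f fadm <-]; apply: le_ereal_inf_tmp => _ [pi hpi <-].
  exact: weak_duality.
have dual_le f : admissible c mu f ->
    (dual_value mu f <= ereal_sup [set dual_value mu f | f in admissible c mu])%E.
  by move=> fadm; apply: ereal_sup_ubound; exists f.
case: (ereal_sup _) dual_le => [S||] dual_le.
- apply/lee_addgt0Pr => eta eta0.
  have [pi hpi pile] := strong_duality K0 hX hcb hcc dual_le eta0.
  by apply: le_trans pile; apply: ereal_inf_lbound; exists pi.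
- exact: leey.
- have [M [_ cM]] := hcb.
  pose a : R := - ((`|M| + 1) / K%:R).
  have : admissible c mu (fun=> cst a).
    split=> [k|k|x]; first exact: measurable_cst.
      exact: finite_measure_integrable_cst.
    rewrite sumr_const card_ord -mulr_natr mulNr divfK ?pnatr_eq0 -?lt0n//.
    have : `|c x| <= `|M| + 1 by apply: cM => //; rewrite ltr_pwDr// ler_norm.
    by rewrite ler_norml => /andP[].
  move=> /dual_le; rewrite leeNy_eq /dual_value (eq_bigr (fun=> a%:E)).
    by rewrite sumEFin.
  move=> k _; apply: etrans (integral_cst (mu k) measurableT a%:E) _.
  by rewrite [X in (_ * X)%E](probability_setT (mu k)) mule1.
Qed.
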